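(* Let $p>1$ and $C_M>0$, and let $X$ be a Banach space which is $p$-AMUC with constant $C_M$. Then there exists $C>0$, depending only on $C_M$ and $p$, such that for all sufficiently large $n$ the minimum distortion necessary for embedding the countably branching diamond graph $D_n^\omega$ into $X$ is at least $Cn^{1/p}$; that is, every bi-Lipschitz embedding $f:D_n^\omega\to X$ satisfies $\mathrm{dist}(f)\ge Cn^{1/p}$.
   Context: $p$-AMUC: for a Banach space $X$ with unit sphere $S_X$, let $\mathrm{cof}(X)$ be the set of closed finite-codimensional subspaces of $X$. For $\epsilon\in(0,1)$ set $$\tilde\delta_X(\epsilon)=\inf_{x\in S_X}\ \sup_{Y\in\mathrm{cof}(X)}\ \inf_{y\in S_Y}\max\{\|x+\epsilon y\|,\|x-\epsilon y\|\}-1 .$$ $X$ is asymptotically midpoint uniformly convex if $\tilde\delta_X(\epsilon)>0$ for every $\epsilon\in(0,1)$; it is $p$-AMUC with constant $C_M>0$ (for $p\in(1,\infty)$) if $\tilde\delta_X(\epsilon)\ge C_M\epsilon^p$ for every $\epsilon\in(0,1)$. Diamond graphs: $D_1^\omega$ is the complete bipartite graph with one side $\{s,t\}$ and the other side $\{x_i\}_{i=1}^\infty$, with directed edges $(s,x_i)$ and $(x_i,t)$ for all $i$. $D_0^\omega$ is a single directed edge from $s$ to $t$. For directed graphs $H,G$ with distinguished vertices $s,t$, the slash product $H\oslash G$ is obtained by replacing each directed edge $(u,v)$ of $H$ by a separate copy of $G$, identifying $s(G)$ with $u$ and $t(G)$ with $v$; one sets $s(H\oslash G)=s(H)$, $t(H\oslash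 G)=t(H)$. Then $D_{n+1}^\omega=D_n^\omega\oslash D_1^\omega$, i.e. $D_n^\omega=(D_1^\omega)^{\oslash^n}$. $D_n^\omega$ is identified with its vertex set, equipped with the shortest path metric of the underlying undirected unweighted graph. Distortion: for metric spaces $(Y,d_Y)$, $(X,d_X)$ and a map $f:Y\to X$, $\mathrm{dist}(f)$ is the smallest $K\ge 1$ for which there is $\lambda>0$ with $\lambda d_Y(x,y)\le d_X(f(x),f(y))\le K\lambda d_Y(x,y)$ for all $x,y\in Y$; $f$ is bi-Lipschitz if such a $K$ exists. *)

(* Defs.v *)
From HB Require Import structures.
From mathcomp Require Import all_boot all_order all_algebra.
From mathcomp Require Import all_classical all_reals all_analysis.
Set Implicit Arguments.
Unset Strict Implicit.
Unset Printing Implicit Defensive.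
Import Order.TTheory GRing.Theory Num.Theory numFieldNormedType.Exports.
Local Open Scope classical_set_scope.
Local Open Scope ring_scope.

(* [X / Y] is finite-dimensional iff finitely many classes [e_0 + Y], ...,
   [e_(m-1) + Y] span it. *)
Definition finite_codim (R : realType) (X : normedModType R) (Y : set X) :=
  exists (m : nat) (e : 'I_m -> X),
    forall x : X, exists c : 'I_m -> R, Y (x - \sum_(i < m) c i *: e i).

Definition cof (R : realType) (X : normedModType R) : set (set X) :=
  [set Y | [/\ submod_closed (mem Y), closed Y & finite_codim Y]].

Definition unit_sphere (R : realType) (X : normedModType R) : set X :=
  [set x | `|x| = 1].

(* Extended-real valued: an infimum over an empty sphere (of [{0}]) is [+oo]. *)
Definition amuc_modulus (R : realType) (X : normedModType R) (eps : R)
    : \bar R :=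
  (ereal_inf
     [set ereal_sup
        [set ereal_inf
           [set (Num.max `|x + eps *: y| `|x - eps *: y|)%:E
            | y in @unit_sphere R X `&` Y]
         | Y in @cof R X]
      | x in @unit_sphere R X]
   - 1)%E.

Definition p_amuc (R : realType) (X : normedModType R) (p CM : R) :=
  forall eps : R, 0 < eps < 1 -> ((CM * eps `^ p)%:E <= amuc_modulus X eps)%E.

(* Directed (multi)graphs with two distinct distinguished vertices. *)
Record st_graph := STGraph {
  vertex : eqType;
  edge : eqType;
  esrc : edge -> vertex;
  etgt : edge -> vertex;
  vs : vertex;
  vt : vertex;
  vs_neq_vt : vs != vt }.

Definition inner_vertex (G : st_graph) : eqType :=
  {w : vertex G | (w != vs G) && (w != vt G)}.

(* The vertices of [H] are kept, and each edge [e] of [H] contributes the inner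
   vertices of its own copy of [G]: this is the quotient identifying, in that
   copy, [vs G] with [esrc e] and [vt G] with [etgt e]. *)
Definition slash_vertex (H G : st_graph) : eqType :=
  (vertex H + edge H * inner_vertex G)%type.

(* The vertex of the slash product given by [w] in the copy of [G] at [e]; the
   [None] branch of [insub] is never reached. *)
Definition slash_emb (H G : st_graph) (e : edge H) (w : vertex G)
    : slash_vertex H G :=
  if w == vs G then inl (esrc e)
  else if w == vt G then inl (etgt e)
  else if insub w is Some w' then inr (e, w') else inl (esrc e).

Lemma slash_vs_neq_vt (H G : st_graph) :
  (inl (vs H) : slash_vertex H G) != inl (vt H).
Proof. exact: vs_neq_vt. Qed.

Definition slash (H G : st_graph) : st_graph :=
  @STGraph (slash_vertex H G) (edge H * edge G)%type
    (fun ef => slash_emb ef.1 (esrc ef.2))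
    (fun ef => slash_emb ef.1 (etgt ef.2))
    (inl (vs H)) (inl (vt H)) (slash_vs_neq_vt H G).

Definition single_edge : st_graph :=
  @STGraph bool unit (fun=> false) (fun=> true) false true isT.

(* Vertices: [inl false] is s, [inl true] is t, [inr i] is x_i.
   Edges: [(i, false)] is (s, x_i) and [(i, true)] is (x_i, t). *)
Definition diamond1 : st_graph :=
  @STGraph (bool + nat)%type (nat * bool)%type
    (fun ib => if ib.2 then inr ib.1 else inl false)
    (fun ib => if ib.2 then inl true else inr ib.1)
    (inl false) (inl true) isT.

(* [diamond 1] is [slash single_edge diamond1], a relabelled [diamond1]. *)
Fixpoint diamond (n : nat) : st_graph :=
  if n is m.+1 then slash (diamond m) diamond1 else single_edge.

Definition adj (G : st_graph) : rel (vertex G) := fun x y =>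
  `[< exists e : edge G,
        (esrc e = x /\ etgt e = y) \/ (esrc e = y /\ etgt e = x) >].

(* Shortest path metric, for a connected [G] (a real infimum over the empty set
   is 0). *)
Definition graph_dist (R : realType) (G : st_graph) (x y : vertex G) : R :=
  inf [set (size w)%:R | w in [set w | path (@adj G) x w /\ last x w = y]].

Definition has_distortion (R : realType) (S T : Type)
    (dS : S -> S -> R) (dT : T -> T -> R) (f : S -> T) (K : R) :=
  1 <= K /\ exists lam : R, 0 < lam /\
    forall x y, lam * dS x y <= dT (f x) (f y) <= K * lam * dS x y.

Definition bilipschitz (R : realType) (S T : Type)
    (dS : S -> S -> R) (dT : T -> T -> R) (f : S -> T) :=
  exists K, has_distortion dS dT f K.

(* [+oo] if [f] is not bi-Lipschitz; otherwise the infimum is attained. *)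
Definition distortion (R : realType) (S T : Type)
    (dS : S -> S -> R) (dT : T -> T -> R) (f : S -> T) : \bar R :=
  ereal_inf [set K%:E | K in [set K | has_distortion dS dT f K]].

Definition norm_dist (R : realType) (X : normedModType R) (u v : X) : R :=
  `|u - v|.

(* Main.v *)
Require Import Defs.
From HB Require Import structures.
From mathcomp Require Import all_boot all_order all_algebra.
From mathcomp Require Import all_classical all_reals all_analysis.
From mathcomp Require Import lra.
Import Order.TTheory GRing.Theory Num.Theory numFieldNormedType.Exports.
Local Open Scope classical_set_scope.
Local Open Scope ring_scope.
Set Implicit Arguments.
Unset Strict Implicit.
Unset Printing Implicit Defensive.

(** A map of distortion [K] stretches every edge of [diamond n] by at most [K].
    The proof exhibits an edge stretched by at least [1 + n * theta], where
    [theta] is of the order of [K ^ (1 - p)]; comparing the two gives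
    [n <= C' * K ^ p].

    The edge is found by going down the levels of the diamond.  Let [(u, v)] be
    an edge of some level, of length [2 * a] in the graph, and let [z i] be the
    images of the infinitely many midpoints that replace it at the next level;
    they are [2 * a]-separated.  Suppose that they were all within distance [L]
    of the images of both ends, and let [w] be half the difference of those
    images.  For a subspace [Y] of finite codimension, some [z i - z j] with
    [i != j] almost lies in [Y], because balls are totally bounded modulo [Y]
    ([finite_codim_almost_diff]).  Put [d = (z i - z j) / 2].  Both [w + d] and
    [w - d] are averages of two half-edge differences, so they have norm at most
    [L], whereas [d] has norm at least [a] and is almost in [Y].  For [Y] chosen
    by the convexity of [X] at [w], this forces [L] to exceed [`|w|] by a fixed
    amount ([stretched_half_edge]): one of the half-edges at [z i] is stretched
    more than [(u, v)] was, by at least [theta].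

    The separation of the midpoints is inherited from level to level through
    functions that vary by at most [1] along edges.  Such a function bounds the
    graph distance from below, and it extends to the subdivided graph with its
    values doubled on the old vertices ([subdivide_lipschitz]).  In these terms
    the induction on [n] only needs restriction of [f] to the old vertices. *)

(** * Total boundedness modulo a subspace of finite codimension *)

Lemma seq_norm_bounded (R : realType) (X : normedModType R) (F : seq X) :
  exists M : R, forall q, q \in F -> `|q| <= M.
Proof.
elim: F => [|q F [M hM]]; first by exists 0.
exists (Num.max `|q| M) => q'; rewrite inE => /orP[/eqP->|/hM h].
  by rewrite le_max lexx.
by rewrite le_max h orbT.
Qed.

Lemma interval_net (R : realType) (T h : R) : 0 < h ->
  exists s : seq R, forall t, `|t| <= T -> exists2 u, u \in s & `|t - u| <= h.
Proof.
move=> h0; pose N := (Num.trunc ((T + T) / h)).+1.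
exists [seq h * k%:R - T | k <- iota 0 N] => t.
rewrite ler_norml => /andP[t1 t2].
have q0 : 0 <= (t + T) / h by rewrite divr_ge0 ?(ltW h0) //; lra.
exists (h * (Num.trunc ((t + T) / h))%:R - T).
  apply/mapP; exists (Num.trunc ((t + T) / h)) => //.
  rewrite mem_iota add0n /N ltnS le_truncn //.
  by rewrite ler_pM2r ?invr_gt0 //; lra.
have /andP[] := truncn_itv q0.
rewrite -natr1; set k : R := _%:R.
rewrite ler_pdivlMr // ltr_pdivrMr // => k1 k2.
by rewrite ler_norml; apply/andP; split; nra.
Qed.

(** Induction on the number of generators: the first one, [e ord0], is absorbed
    into [Y] and then its coefficient is discretized.  If [e ord0] is at positive
    distance [d] from [Y], then that coefficient is bounded and a finite net of
    an interval will do.  If instead [e ord0] is a limit of points of [Y], its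
    coefficient may be arbitrarily large, but every multiple of [e ord0] is
    itself approximated by [Y]. *)
Lemma quotient_totally_bounded (R : realType) (X : normedModType R) (m : nat)
    (Y : set X) (e : 'I_m -> X) :
  submod_closed (mem Y) ->
  (forall x, exists c : 'I_m -> R, Y (x - \sum_(i < m) c i *: e i)) ->
  forall r eta : R, 0 < eta ->
  exists F : seq X, forall x, `|x| <= r ->
    exists2 q, q \in F & exists2 y, Y y & `|x - q - y| <= eta.
Proof.
elim: m Y e => [|m IH] Y e [/set_mem Y0 YL] hY r eta eta0.
  exists [:: 0] => x _; exists 0; first by rewrite inE.
  have [c] := hY x; rewrite big_ord0 !subr0 => Yx.
  by exists x; rewrite ?subrr ?normr0 ?ltW.
have {}YL a u v : Y u -> Y v -> Y (a *: u + v).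
  by move=> Yu Yv; apply: set_mem; apply: YL; apply: mem_set.
have YZ a u : Y u -> Y (a *: u) by move=> Yu; rewrite -[_ *: _]addr0; exact: YL.
have YD u v : Y u -> Y v -> Y (u + v).
  by move=> Yu; rewrite -[u]scale1r; exact: YL.
pose Y' : set X := [set x | exists t, Y (x - t *: e ord0)].
have Y'sub : submod_closed (mem Y').
  split; first by apply/mem_set; exists 0; rewrite scale0r subr0.
  move=> a u v /set_mem[s Yu] /set_mem[t Yv]; apply/mem_set; exists (a * s + t).
  rewrite (_ : _ - _ = a *: (u - s *: e ord0) + (v - t *: e ord0)).
    exact: YL.
  by rewrite scalerBr scalerA scalerDl opprD addrACA.
have hY' x : exists c : 'I_m -> R,
    Y' (x - \sum_(i < m) c i *: e (lift ord0 i)).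
  have [c] := hY x; rewrite big_ord_recl => Yx.
  exists (fun i => c (lift ord0 i)); exists (c ord0).
  by rewrite -addrA -opprD [_ + c _ *: _]addrC.
have eta20 : 0 < eta / 2 by lra.
have [F hF] := IH Y' _ Y'sub hY' r _ eta20.
have [near|/existsNP[d /not_implyP[d0 far]]] := pselect (forall d : R, 0 < d ->
    exists2 y, Y y & `|e ord0 - y| <= d).
  exists F => x /hF[q qF [y' [t Yy] hy]]; exists q => //.
  have t0 : 0 < `|t| + 1 by rewrite ltr_wpDl.
  have [z Yz hz] := near (eta / 2 / (`|t| + 1)) (divr_gt0 eta20 t0).
  exists (y' - t *: e ord0 + t *: z); first by apply: YD => //; exact: YZ.
  have -> : x - q - (y' - t *: e ord0 + t *: z)
      = (x - q - y') + t *: (e ord0 - z).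
    by rewrite scalerBr !opprD opprK !addrA.
  apply: (le_trans (ler_normD _ _)).
  have : `|t *: (e ord0 - z)| <= eta / 2.
    rewrite normrZ; apply: (@le_trans _ _ (`|t| * (eta / 2 / (`|t| + 1)))).
      exact: ler_wpM2l.
    rewrite mulrA ler_pdivrMr // mulrC ler_wpM2l ?(ltW eta20) //.
    by rewrite lerDl.
  by move: hy; lra.
have dfar y : Y y -> d <= `|e ord0 - y|.
  move=> Yy; rewrite leNgt; apply/negP => /ltW hd; apply: far; by exists y.
have tbound t y : Y y -> `|t| * d <= `|y + t *: e ord0|.
  move=> Yy; have [->|t0] := eqVneq t 0; first by rewrite normr0 mul0r.
  have -> : y + t *: e ord0 = t *: (e ord0 - (- t^-1) *: y).
    by rewrite scaleNr opprK scalerDr scalerA mulfV // scale1r addrC.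
  rewrite normrZ ler_wpM2l //; apply: dfar; exact: YZ.
have [M hM] := seq_norm_bounded F.
have h0 : 0 < eta / 2 / (`|e ord0| + 1) by rewrite divr_gt0 // ltr_wpDl.
have [s hs] := interval_net ((r + M + eta / 2) / d) h0.
exists [seq q + u *: e ord0 | q <- F, u <- s] => x xr.
have [q qF [y' [t Yy] hy]] := hF x xr.
have /hs[u us tu] : `|t| <= (r + M + eta / 2) / d.
  rewrite ler_pdivlMr //; apply: (le_trans (tbound _ _ Yy)); rewrite subrK.
  have -> : y' = x - q - (x - q - y') by rewrite opprB addrC subrK.
  apply: (le_trans (ler_normB _ _)); have := ler_normB x q; have := hM q qF.
  by lra.
exists (q + u *: e ord0); first by apply/allpairsP; exists (q, u).
exists (y' - t *: e ord0) => //.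
have -> : x - (q + u *: e ord0) - (y' - t *: e ord0)
    = (x - q - y') + (t - u) *: e ord0.
  by rewrite scalerBl !opprD opprK !addrA [in RHS]addrAC; congr (_ + _);
     rewrite addrAC.
apply: (le_trans (ler_normD _ _)); rewrite normrZ.
have : `|t - u| * `|e ord0| <= eta / 2.
  apply: (@le_trans _ _ (eta / 2 / (`|e ord0| + 1) * `|e ord0|)).
    exact: ler_wpM2r.
  by rewrite mulrAC ler_pdivrMr ?ltr_wpDl // ler_wpM2l ?(ltW eta20) ?lerDl.
by move: hy; lra.
Qed.

(** Pigeonhole: two terms of the sequence are close, modulo [Y], to the same point
    of a finite net. *)
Lemma finite_codim_almost_diff (R : realType) (X : normedModType R)
    (Y : set X) (z : nat -> X) (r eta : R) :
  submod_closed (mem Y) -> finite_codim Y -> 0 < eta ->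
  (forall i, `|z i| <= r) ->
  exists i j, i != j /\ exists2 y, Y y & `|z i - z j - y| <= eta.
Proof.
move=> Ysub [m [e hY]] eta0 zr.
have eta20 : 0 < eta / 2 by lra.
have [F hF] := quotient_totally_bounded Ysub hY r eta20.
have /choice[q hq] : forall i, exists q, q \in F /\
    exists2 y, Y y & `|z i - q - y| <= eta / 2.
  by move=> i; have [q qF h] := hF _ (zr i); exists q.
have idx (i : 'I_(size F).+1) : (index (q i) F < size F)%N.
  by rewrite index_mem; have [] := hq i.
have [i [j [ij qij]]] : exists i j : nat, i != j /\ q i = q j.
  apply: contrapT => H.
  have /leq_card : injective (fun i => Ordinal (idx i)).
    move=> i j [] /(congr1 (nth 0 F)); have [iF _] := hq i.
    have [jF _] := hq j; rewrite !nth_index // => qij.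
    by apply: contrapT => /eqP ij; apply: H; exists i, j.
  by rewrite !card_ord ltnn.
exists i, j; split => //.
have [_ [y Yy hy]] := hq i; have [_ [y' Yy' hy']] := hq j.
exists (y - y').
  apply: set_mem; case: Ysub => _ /(_ (-1) y' y).
  by rewrite scaleN1r [_ + y]addrC; apply; exact: mem_set.
have -> : z i - z j - (y - y') = (z i - q i - y) - (z j - q j - y').
  have swap (a b c d : X) : (a - c) - (b - d) = (a - b) - (c - d).
    by rewrite !opprD addrACA.
  by rewrite [RHS]swap qij; congr (_ - _); rewrite opprB addrA subrK.
apply: (le_trans (ler_normB _ _)); by lra.
Qed.

(** * Asymptotic midpoint convexity applied to separated midpoints *)

(** Both [x + y] and [x - y] lie on the segment from [x - t *: y] to
    [x + t *: y], and the norm is convex. *)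
Lemma max_norm_ray (R : realType) (X : normedModType R) (x y : X) (t : R) :
  1 <= t ->
  Num.max `|x + y| `|x - y| <= Num.max `|x + t *: y| `|x - t *: y|.
Proof.
move=> t1; set M := (X in _ <= X).
have t0 : 0 < t by lra.
have tV : 0 < t^-1 <= 1 by rewrite invr_gt0 t0 invf_le1.
have hull (s : R) : `|s| <= 1 -> `|x + (s * t) *: y| <= M.
  rewrite ler_norml => /andP[s1 s2].
  have -> : x + (s * t) *: y
      = ((1 + s) / 2) *: (x + t *: y) + ((1 - s) / 2) *: (x - t *: y).
    rewrite scalerBr !scalerDr addrACA -scalerDl -!scalerA -scalerBl.
    by congr (_ + _); [rewrite -[LHS]scale1r | rewrite !scalerA];
       congr (_ *: _); lra.
  apply: (le_trans (ler_normD _ _)); rewrite !normrZ !ger0_norm; try lra.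
  have : `|x + t *: y| <= M by rewrite /M le_max lexx.
  have : `|x - t *: y| <= M by rewrite /M le_max lexx orbT.
  by nra.
rewrite ge_max; apply/andP; split.
  have := hull t^-1; rewrite mulVf ?gt_eqF // scale1r; apply.
  by rewrite ger0_norm; lra.
have := hull (- t^-1); rewrite mulNr mulVf ?gt_eqF // scaleN1r; apply.
by rewrite normrN ger0_norm; lra.
Qed.

(** The supremum over [Y] need not be attained, hence the slack [c < CM]. *)
Lemma p_amuc_sphere (R : realType) (X : normedModType R) (p CM c eps : R)
    (x : X) :
  p_amuc X p CM -> c < CM -> 0 < eps < 1 -> `|x| = 1 ->
  exists2 Y, cof Y & forall y, Y y -> `|y| = 1 ->
    1 + c * eps `^ p <= Num.max `|x + eps *: y| `|x - eps *: y|.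
Proof.
move=> amuc cCM eps01 x1.
have eps0 : 0 < eps `^ p by rewrite powR_gt0; lra.
have := amuc _ eps01; rewrite /amuc_modulus leeBrDr // => hI.
have : ((1 + c * eps `^ p)%:E <
    ereal_sup [set ereal_inf
      [set (Num.max `|x + eps *: y| `|x - eps *: y|)%:E
          | y in @unit_sphere R X `&` Y] | Y in @cof R X])%E.
  apply: (@lt_le_trans _ _ (CM * eps `^ p + 1)%:E).
    by rewrite lte_fin addrC ltrD2r ltr_pM2r.
  rewrite EFinD; apply: (le_trans hI); apply: ereal_inf_lbound.
  by exists x.
move=> /ereal_sup_gt[_ [Y cofY <-] hY]; exists Y => // y Yy y1.
rewrite -lee_fin; apply: (le_trans (ltW hY)); apply: ereal_inf_lbound.
by exists y.
Qed.

(** Homogeneous form: [w] is normalized, and [max_norm_ray] passes from vectors of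
    norm exactly [s] to longer ones. *)
Lemma p_amuc_scaled (R : realType) (X : normedModType R) (p CM c s : R)
    (w : X) :
  p_amuc X p CM -> c < CM -> 0 < s < `|w| ->
  exists2 Y, cof Y & forall y, Y y -> s <= `|y| ->
    `|w| * (1 + c * (s / `|w|) `^ p) <= Num.max `|w + y| `|w - y|.
Proof.
move=> amuc cCM /andP[s0 sw].
have w0 : 0 < `|w| by lra.
have x1 : `| `|w|^-1 *: w| = 1.
  by rewrite normrZ ger0_norm ?invr_ge0 // mulVf ?gt_eqF.
have eps01 : 0 < s / `|w| < 1.
  by rewrite divr_gt0 // ltr_pdivrMr // mul1r.
have [Y cofY hY] := p_amuc_sphere amuc cCM eps01 x1.
exists Y => // y Yy sy.
have y0 : 0 < `|y| by lra.
have YZ (a : R) u : Y u -> Y (a *: u).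
  case: cofY => -[Y0 YL] _ _ Yu; rewrite -[_ *: _]addr0; apply: set_mem.
  by apply: YL => //; exact: mem_set.
have y1 : `| `|y|^-1 *: y| = 1.
  by rewrite normrZ ger0_norm ?invr_ge0 // mulVf ?gt_eqF.
have := hY _ (YZ (`|y|^-1) _ Yy) y1.
set z := (s / `|w|) *: _ => hz.
have t1 : 1 <= `|y| / s by rewrite ler_pdivlMr // mul1r.
have /(le_trans hz) := max_norm_ray (`|w|^-1 *: w) z t1.
have -> : (`|y| / s) *: z = `|w|^-1 *: y.
  rewrite /z !scalerA; congr (_ *: _).
  rewrite mulrA [X in X * _](_ : _ = `|y| / `|w|); last first.
    by rewrite mulrA divfK ?gt_eqF.
  by rewrite mulrAC mulfV ?gt_eqF // mul1r.
rewrite -scalerDr -scalerBr !normrZ ger0_norm ?invr_ge0 //.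
by rewrite -maxr_pMr ?invr_ge0 // ler_pdivlMl.
Qed.

(** The increase of the stretch from an edge to one of its halves, when all
    stretches are at most [K].  An edge of stretch [l] gains [CM * l * eps ^ p]
    for [eps = 1 / (2 * l)], that is [CM / 2 * eps ^ (p - 1)], which is smallest
    at [l = K].  The remaining factor [1 / 4] pays for replacing [CM] by [CM / 2]
    and for the error of the approximation by [Y]. *)
Definition stretch_gain (R : realType) (p CM K : R) : R :=
  CM / 8 * (2 * K)^-1 `^ (p - 1).

(** If both halves at every [z i] were short, then so would be [w + d] and [w - d]
    with [w = (u - v) / 2] and [d = (z i - z j) / 2]; for [i != j] with [d] close
    to a suitable [Y], this contradicts the convexity at [w].  Although [d] has
    norm at least [a], the convexity is used at length [a / 2]: this keeps
    [eps = a / 2 / `|w|] below [1] and leaves room for the distance from [d] to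
    [Y]. *)
Lemma stretched_half_edge (R : realType) (X : normedModType R)
    (p CM a K : R) (u v : X) (z : nat -> X) :
  1 <= p -> 0 < CM -> p_amuc X p CM -> 0 < a ->
  2 * a <= `|u - v| <= 2 * a * K ->
  (forall i j, i != j -> 2 * a <= `|z i - z j|) ->
  exists i, `|u - v| / 2 + a * stretch_gain p CM K
            <= Num.max `|u - z i| `|z i - v|.
Proof.
move=> p1 CM0 amuc a0 /andP[uv1 uv2] zsep; apply: contrapT => /forallNP close.
set L := `|u - v| / 2 + _ in close.
pose w := 2^-1 *: (u - v).
have nw : `|w| = `|u - v| / 2 by rewrite normrZ ger0_norm ?invr_ge0 // mulrC.
pose b := (2 * K)^-1.
have K1 : 1 <= K by nra.
have b0 : 0 < b by rewrite invr_gt0; lra.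
have sw : 0 < a / 2 < `|w| by rewrite nw; lra.
have w0 : 0 < `|w| by lra.
have cCM : CM / 2 < CM by lra.
have [Y cofY hY] := p_amuc_scaled amuc cCM sw.
pose x := a / 2 / `|w|.
have bx : b <= x.
  rewrite /b /x ler_pdivlMr // ler_pdivrMl; last lra.
  by rewrite nw; lra.
have x0 : 0 < x by lra.
pose g := CM / 2 * b `^ (p - 1).
have bp0 : 0 < b `^ (p - 1) by rewrite powR_gt0.
have gain : stretch_gain p CM K = g / 4 by rewrite /stretch_gain -/b /g; lra.
have g0 : 0 < g by rewrite mulr_gt0 // divr_gt0.
have wx : `|w| * x = a / 2 by rewrite /x mulrC divfK ?gt_eqF.
have big y : Y y -> a / 2 <= `|y| ->
    `|w| + a * (g / 2) <= Num.max `|w + y| `|w - y|.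
  move=> Yy /(hY y Yy); apply: le_trans; rewrite -/x.
  have -> : x `^ p = x * x `^ (p - 1).
    rewrite -{2}[x]powRr1 ?ltW // -powRD; last by rewrite (gt_eqF x0) implybT.
    by congr (_ `^ _); lra.
  have : b `^ (p - 1) <= x `^ (p - 1).
    by apply: ge0_ler_powR => //; rewrite ?nnegrE; lra.
  set B := b `^ _; set D := x `^ _ => BD.
  rewrite mulrDr mulr1 lerD2l /g -/B.
  have -> : `|w| * (CM / 2 * (x * D)) = CM / 2 * (a / 2) * D.
    by rewrite -wx; lra.
  by have := ler_wpM2l (ltW (mulr_gt0 CM0 a0)) BD; lra.
have lt_u i : `|u - z i| < L.
  by have /negP := close i; rewrite -ltNge gt_max => /andP[].
have lt_v i : `|z i - v| < L.
  by have /negP := close i; rewrite -ltNge gt_max => /andP[].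
have zr i : `|2^-1 *: z i| <= L + `|u|.
  rewrite normrZ ger0_norm ?invr_ge0 //.
  have := ler_normB u (u - z i); rewrite subKr.
  by have := lt_u i; have := normr_ge0 u; have := normr_ge0 (u - z i); lra.
pose eta := Num.min (a / 2) (a * (g / 4)).
have eta0 : 0 < eta by rewrite lt_min !mulr_gt0 //; lra.
have [eta1 eta2] : eta <= a / 2 /\ eta <= a * (g / 4).
  by rewrite !ge_min !lexx orbT.
have [Ysub _ Yfin] := cofY.
have [i [j [ij [y Yy hy]]]] := finite_codim_almost_diff Ysub Yfin eta0 zr.
pose d := 2^-1 *: z i - 2^-1 *: z j.
have nd : a <= `|d|.
  rewrite /d -scalerBr normrZ ger0_norm ?invr_ge0 //.
  by have := zsep _ _ ij; lra.
have ny : a / 2 <= `|y|.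
  have := ler_normD (d - y) y; rewrite subrK.
  by move: hy; rewrite -/d; lra.
have half (s t : X) : `|s| < L -> `|t| < L -> `|2^-1 *: (s + t)| < L.
  move=> hs ht; rewrite normrZ ger0_norm ?invr_ge0 //.
  by have := ler_normD s t; lra.
have := big y Yy ny; rewrite leNgt => /negP; apply.
rewrite gt_max.
(* Each of [w + d] and [w - d] becomes the average of a half-edge difference at
   [z i] and one at [z j]. *)
have cross (q r s t : X) : (q - r) + (s - t) = (q - t) + (s - r).
  by rewrite addrACA [- r - t]addrC addrACA.
have -> : w + y = 2^-1 *: ((u - z j) + (z i - v)) - (d - y).
  rewrite -cross scalerDr -/w (scalerBr _ (z i)) -/d -addrA.
  by congr (_ + _); rewrite opprB addrC subrK.
have -> : w - y = 2^-1 *: ((u - z i) + (z j - v)) + (d - y).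
  rewrite -cross scalerDr -/w -[z j - z i]opprB scalerN (scalerBr _ (z i)) -/d.
  by rewrite addrA subrK.
have LL : L + eta <= `|w| + a * (g / 2) by rewrite /L gain nw; lra.
apply/andP; split.
  apply: (le_lt_trans (ler_normB _ _)); have := half _ _ (lt_u j) (lt_v i).
  by move: hy; rewrite -/d; lra.
apply: (le_lt_trans (ler_normD _ _)); have := half _ _ (lt_u i) (lt_v j).
by move: hy; rewrite -/d; lra.
Qed.

(** * Graph distance and functions that are 1-Lipschitz along edges *)

Definition reachable (G : st_graph) (x y : vertex G) :=
  exists w, path (@adj G) x w /\ last x w = y.

Lemma reachable_refl (G : st_graph) (x : vertex G) : reachable x x.
Proof. by exists [::]. Qed.

Lemma reachable_trans (G : st_graph) (y x z : vertex G) :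
  reachable x y -> reachable y z -> reachable x z.
Proof.
move=> [w [pw <-]] [w' [pw' <-]]; exists (w ++ w').
by rewrite cat_path pw pw' last_cat.
Qed.

Lemma adj_sym (G : st_graph) : symmetric (@adj G).
Proof.
by move=> x y; apply: asbool_equiv_eq; split=> -[e [?|?]]; exists e; tauto.
Qed.

Lemma reachable_sym (G : st_graph) (x y : vertex G) :
  reachable x y -> reachable y x.
Proof.
move=> [w [pw <-]]; exists (rev (belast x w)); split.
  by rewrite rev_path (eq_path (e' := @adj G)) // => u v; exact: adj_sym.
by case: w {pw} => //= u w; rewrite rev_cons last_rcons.
Qed.

Lemma adj_edge (G : st_graph) (e : edge G) : adj (esrc e) (etgt e).
Proof. by apply/asboolP; exists e; left. Qed.

Lemma reachable_edge (G : st_graph) (e : edge G) : reachable (esrc e) (etgt e).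
Proof. by exists [:: etgt e]; rewrite /= adj_edge. Qed.

Definition edge_lipschitz (R : realType) (G : st_graph) (g : vertex G -> R) :=
  forall e : edge G, `|g (esrc e) - g (etgt e)| <= 1.

Lemma edge_lipschitz_le_graph_dist (R : realType) (G : st_graph)
    (g : vertex G -> R) (x y : vertex G) :
  edge_lipschitz g -> reachable x y -> `|g x - g y| <= graph_dist R x y.
Proof.
move=> gL [w0 hw0]; apply: lb_le_inf; first by exists (size w0)%:R, w0.
move=> _ [w [pw <-] <-]; elim: w x pw {hw0} => [|z w IH] x /=.
  by rewrite subrr normr0.
move=> /andP[/asboolP[e he] /IH]; have : `|g x - g z| <= 1.
  by case: he => -[<- <-]; [|rewrite distrC]; exact: gL.
have := ler_distD (g z) (g x) (g (last z w)).
by rewrite -[(size w).+1]addn1 natrD; lra.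
Qed.

Lemma graph_dist_edge_le1 (R : realType) (G : st_graph) (e : edge G) :
  graph_dist R (esrc e) (etgt e) <= 1.
Proof.
apply: ge_inf; last by exists [:: etgt e] => //=; rewrite adj_edge.
by exists 0 => _ [w _ <-].
Qed.

(** * Subdividing every edge through countably many midpoints *)

Section Subdivision.
Variable H : st_graph.
Local Notation H' := (slash H diamond1).

Definition midvertex (e : edge H) (i : nat) : vertex H' :=
  slash_emb e (inr i : vertex diamond1).

Lemma midvertexE (e : edge H) (i : nat) :
  exists2 w : inner_vertex diamond1, midvertex e i = inr (e, w)
    & val w = inr i.
Proof.
rewrite /midvertex /slash_emb /=.
by case: insubP => [w _ ww|] //=; exists w.
Qed.

Lemma midvertex_onto (e : edge H) (w : inner_vertex diamond1) :
  exists i, inr (e, w) = midvertex e i.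
Proof.
case wE : (val w) (valP w) => [[]|i] // _; exists i.
have [w' -> w'E] := midvertexE e i; congr (inr (_, _)).
by apply: val_inj; rewrite wE w'E.
Qed.

Lemma midvertex_inj (e : edge H) : injective (midvertex e).
Proof.
move=> i j; have [w -> wE] := midvertexE e i.
have [w' -> w'E] := midvertexE e j.
by move=> [ww]; move: wE; rewrite ww w'E => -[].
Qed.

Lemma esrc_half (e : edge H) (i : nat) (b : bool) :
  esrc ((e, (i, b)) : edge H') = if b then midvertex e i else inl (esrc e).
Proof. by case: b. Qed.

Lemma etgt_half (e : edge H) (i : nat) (b : bool) :
  etgt ((e, (i, b)) : edge H') = if b then inl (etgt e) else midvertex e i.
Proof. by case: b. Qed.

(** Connectedness matters because [graph_dist] takes the value [0], not infinity,
    between vertices in different components: [edge_lipschitz_le_graph_dist]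
    would fail there. *)
Lemma reachable_subdivision :
  (forall x y : vertex H, reachable x y) ->
  forall x y : vertex H', reachable x y.
Proof.
move=> Hconn.
have half1 e i : reachable (inl (esrc e) : vertex H') (midvertex e i).
  exact: (reachable_edge ((e, (i, false)) : edge H')).
have half2 e i : reachable (midvertex e i) (inl (etgt e) : vertex H').
  exact: (reachable_edge ((e, (i, true)) : edge H')).
have whole e : reachable (inl (esrc e) : vertex H') (inl (etgt e)).
  exact: reachable_trans (half1 e 0%N) (half2 e 0%N).
have old x y : reachable (inl x : vertex H') (inl y).
  have [w [pw <-]] := Hconn x y; elim: w x pw => [|z w IH] x /=.
    by move=> _; exact: reachable_refl.
  move=> /andP[/asboolP[e he] /IH]; apply: reachable_trans.
  by case: he => -[<- <-]; [|apply: reachable_sym]; exact: whole.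
have to_old x : exists z, reachable x (inl z : vertex H').
  case: x => [z|[e w]]; first by exists z; exact: reachable_refl.
  by have [i ->] := midvertex_onto e w; exists (etgt e).
move=> x y; have [z xz] := to_old x; have [z' yz'] := to_old y.
apply: reachable_trans xz _; apply: reachable_trans (old z z') _.
exact: reachable_sym.
Qed.

(** Old distances double in the subdivided graph, so [2 * g] is the right value on
    old vertices; a midpoint gets the average of its two neighbours. *)
Definition subdivide (R : realType) (g : vertex H -> R) (x : vertex H') : R :=
  match x with
  | inl z => 2 * g z
  | inr (e, _) => g (esrc e) + g (etgt e)
  end.

Lemma subdivide_lipschitz (R : realType) (g : vertex H -> R) :
  edge_lipschitz g -> edge_lipschitz (subdivide g).
Proof.
move=> gL [e [i b]]; rewrite esrc_half etgt_half.
have [w -> _] := midvertexE e i; apply: le_trans (gL e).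
by case: b => /=; rewrite le_eqVlt; apply/orP; left; apply/eqP; congr `|_|; lra.
Qed.

(** Every edge of the subdivided graph has exactly one old end, where this
    function vanishes.  It differs by [2] between the two midpoints, which
    witnesses that their distance is [2]. *)
Lemma mid_difference_lipschitz (R : realType) (e : edge H) (i j : nat) :
  edge_lipschitz (fun x : vertex H' =>
    (x == midvertex e i)%:R - (x == midvertex e j)%:R : R).
Proof.
move=> [e' [k b]]; rewrite esrc_half etgt_half.
have [w -> _] := midvertexE e i; have [w' -> _] := midvertexE e j.
case: b; rewrite /=.
  rewrite [X in _ - X]subrr subr0.
  by do 2 case: (_ == _); rewrite ler_norml /=; lra.
rewrite [X in X - _]subrr sub0r normrN.
by do 2 case: (_ == _); rewrite ler_norml /=; lra.
Qed.

End Subdivision.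

(** * Growth of the stretch along the levels of the diamond *)

Lemma reachable_diamond (n : nat) (x y : vertex (diamond n)) : reachable x y.
Proof.
elim: n x y => [|n IH]; last exact: reachable_subdivision.
have st : @reachable single_edge false true.
  exact: (reachable_edge (tt : edge single_edge)).
case=> -[] //; try by exists [::].
exact: reachable_sym st.
Qed.

(** Dual form of [a * graph_dist x y <= `|f x - f y|]: the distance is replaced by
    the functions that bound it from below, so that paths in the subdivided
    graph need not be analysed. *)
Definition lower_lipschitz (R : realType) (G : st_graph) (X : normedModType R)
    (a : R) (f : vertex G -> X) :=
  forall g : vertex G -> R, edge_lipschitz g ->
  forall x y, a * `|g x - g y| <= `|f x - f y|.

(** Restricted to the old vertices, [f] satisfies the same hypotheses with [2 * a]
    in place of [a]; the edge found there has a half whose stretch is larger by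
    [stretch_gain]. *)
Lemma stretched_edge (R : realType) (X : normedModType R) (p CM K : R)
    (n : nat) (a : R) (f : vertex (diamond n) -> X) :
  1 <= p -> 0 < CM -> p_amuc X p CM -> 0 < a ->
  lower_lipschitz a f ->
  (forall e : edge (diamond n), `|f (esrc e) - f (etgt e)| <= K * a) ->
  exists e : edge (diamond n),
    a * (1 + n%:R * stretch_gain p CM K) <= `|f (esrc e) - f (etgt e)|.
Proof.
move=> p1 CM0 amuc; elim: n a f => [|n IH] a f a0 lower upper.
  exists tt; rewrite mul0r addr0.
  have := lower (fun b : bool => b%:R) _ false true.
  by rewrite sub0r normrN normr1; apply => e; rewrite /= sub0r normrN normr1.
have K0 : 0 <= stretch_gain p CM K.
  by rewrite mulr_ge0 ?powR_ge0 // divr_ge0 // ltW.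
set fH := fun x : vertex (diamond n) => f (inl x).
have upperH e : `|fH (esrc e) - fH (etgt e)| <= K * (2 * a).
  have h1 := upper (e, (0%N, false)); have h2 := upper (e, (0%N, true)).
  move: h1 h2; rewrite !esrc_half !etgt_half => h1 h2.
  by have := ler_distD (f (midvertex e 0)) (fH (esrc e)) (fH (etgt e)); lra.
have [|g gL x y|//|e he] := IH (2 * a) fH.
- by lra.
- have := lower _ (subdivide_lipschitz gL) (inl x) (inl y).
  by rewrite /= -mulrBr normrM ger0_norm //; lra.
have an0 : 0 <= a * (n%:R * stretch_gain p CM K).
  exact: mulr_ge0 (ltW a0) (mulr_ge0 (ler0n _ _) K0).
have sep i j : i != j -> 2 * a <= `|f (midvertex e i) - f (midvertex e j)|.
  move=> ij; have := lower _ (@mid_difference_lipschitz _ R e i j)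
    (midvertex e i) (midvertex e j).
  rewrite !eqxx !(inj_eq (@midvertex_inj _ e)) [j == i]eq_sym (negbTE ij).
  by rewrite /= subr0 sub0r opprK ger0_norm; lra.
have uv : 2 * a <= `|fH (esrc e) - fH (etgt e)| <= 2 * a * K.
  by have eK := upperH e; apply/andP; split; lra.
have [i] := stretched_half_edge p1 CM0 amuc a0 uv sep.
have succ : n.+1%:R = n%:R + 1 :> R by rewrite natr1.
rewrite succ le_max => /orP[] hi.
  exists (e, (i, false)); rewrite esrc_half etgt_half.
  by apply: le_trans hi; lra.
exists (e, (i, true)); rewrite esrc_half etgt_half.
by apply: le_trans hi; lra.
Qed.

(** It remains to solve [K >= 1 + n * stretch_gain p CM K] for [K]: multiplying by
    [(2 * K) ^ (p - 1)] yields [(2 * K) ^ p >= CM / 4 * n]. *)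
Theorem theorem3p5 (R : realType) (p CM : R) (hp : 1 < p) (hCM : 0 < CM) :
  exists C : R, 0 < C /\
    forall X : completeNormedModType R, p_amuc X p CM ->
    exists N : nat, forall n : nat, (N <= n)%N ->
    forall f : vertex (diamond n) -> X,
      bilipschitz (@graph_dist R (diamond n)) (@norm_dist R X) f ->
      ((C * n%:R `^ p^-1)%:E
        <= distortion (@graph_dist R (diamond n)) (@norm_dist R X) f)%E.
Proof.
have CM4 : 0 < CM / 4 by lra.
exists ((CM / 4) `^ p^-1 / 2); split; first by rewrite divr_gt0 ?powR_gt0.
move=> X amuc; exists 0%N => n _ f _.
apply: le_ereal_inf_tmp => _ [K [K1 [a [a0 hf]]] <-]; rewrite lee_fin.
have lower : lower_lipschitz a f.
  move=> g gL x y; have /andP[] := hf x y; rewrite /norm_dist => h _.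
  apply: le_trans h; rewrite ler_pM2l //.
  exact: edge_lipschitz_le_graph_dist gL (reachable_diamond x y).
have upper e : `|f (esrc e) - f (etgt e)| <= K * a.
  have /andP[_ h] := hf (esrc e) (etgt e); apply: le_trans h _.
  rewrite ler_piMr ?graph_dist_edge_le1 // mulr_ge0 //; lra.
have [e he] := stretched_edge (ltW hp) hCM amuc a0 lower upper.
have := le_trans he (upper e); rewrite [K * a]mulrC ler_pM2l // => growth.
have twoK : 0 < 2 * K by lra.
have P0 : 0 < (2 * K) `^ (p - 1) by rewrite powR_gt0.
have KE : (2 * K) `^ p = 2 * K * (2 * K) `^ (p - 1).
  rewrite -{2}[2 * K]powRr1 ?ltW // -powRD;
    last by rewrite (gt_eqF twoK) implybT.
  by congr (_ `^ _); lra.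
have : CM / 4 * n%:R <= (2 * K) `^ p.
  move: growth; rewrite /stretch_gain -(powR_inv1 (ltW twoK)) -powRrM.
  rewrite mulN1r powRN.
  set P := _ `^ _ in P0 KE *; rewrite KE => growth.
  have PV : P * P^-1 = 1 by rewrite mulfV ?gt_eqF.
  have := ler_wpM2l (ltW P0) growth.
  have -> : P * (1 + n%:R * (CM / 8 * P^-1)) = P + n%:R * CM / 8 * (P * P^-1).
    by lra.
  by rewrite PV; lra.
have pV0 : 0 <= p^-1 by rewrite invr_ge0; lra.
have nn : 0 <= CM / 4 * n%:R by rewrite mulr_ge0 // ltW.
move=> /(ge0_ler_powR pV0); rewrite !nnegrE nn powR_ge0 => /(_ isT isT).
rewrite -powRrM mulfV ?gt_eqF //; last lra.
by rewrite powRr1 ?(ltW twoK) // powRM ?(ltW CM4) //; lra.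
Qed.
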